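(* Let $\mathbb{F}$ be a field of characteristic $0$, let $\mathbb{V}$ be an $n$-dimensional vector space over $\mathbb{F}$ with a basis $b_1,\dots,b_n$, and let $(\cdot,\cdot)$ be the symmetric nondegenerate bilinear form on $\mathbb{V}$ with $(b_i,b_j)=\delta_{ij}$. Let $\mathbb{A}$ be the ternary Jordan algebra on $\mathbb{V}$ with product $[x,y,z]=(y,z)x+(x,z)y+(x,y)z$. Then the reduced algebras $\mathbb{A}_a$ of $\mathbb{A}$ are not Jordan algebras.
   Context: A ternary algebra with trilinear product $[\cdot,\cdot,\cdot]$ is a ternary Jordan algebra if the product is invariant under all permutations of its three arguments and, for all pairs $x=(x_1,x_2)$, $y=(y_1,y_2)$ of elements, the linear map $D_{x,y}(z)=[[z,x_1,x_2],y_1,y_2]-[[z,y_1,y_2],x_1,x_2]$ is a derivation of the ternary product. For a totally commutative ternary algebra $\mathcal{A}$ with product $[\cdot,\cdot,\cdot]$ on a vector space $\mathbb{V}$ and a fixed $a\in\mathbb{V}$, the reduced algebra $\mathcal{A}_a$ is the binary algebra on $\mathbb{V}$ with product $x\cdot y=[a,x,y]$. A Jordan algebra is a commutative (not necessarily associative) algebra over a field of characteristic $\ne 2$ satisfying $(xy)x^2=x(yx^2)$ for all $x,y$.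
   Formalization: The formal theorem assumes n > 1 and (a,a) ≠ 0: if n ≤ 1, or if (a,a) = 0 (for example a = 0 or a nonzero isotropic a), the reduced algebra A_a is a Jordan algebra, so the claim as written fails exactly in these cases. *)

(* Defs.v *)
From HB Require Import structures.
From mathcomp Require Import all_boot all_fingroup all_algebra.
From mathcomp Require Import ring.

Set Implicit Arguments.
Unset Strict Implicit.
Unset Printing Implicit Defensive.

Import GRing.Theory.
Local Open Scope ring_scope.

(* Bilinear products on V are represented by the library's
   {bilinear V -> V -> V}; there is no trilinear counterpart. *)
Record ternaryAlgebra (F : fieldType) (V : lmodType F) := TernaryAlgebra {
  tprod :> V -> V -> V -> V;
  tprod_linear1 : forall y z, linear (fun x => tprod x y z);
  tprod_linear2 : forall x z, linear (fun y => tprod x y z);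
  tprod_linear3 : forall x y, linear (fun z => tprod x y z) }.

Section TernaryAlgebras.
Variables (F : fieldType) (V : lmodType F).
Implicit Types A : ternaryAlgebra V.

Definition totally_commutative A :=
  forall (s : 'S_3) (x : 'I_3 -> V),
    A (x (s 0)) (x (s 1)) (x (s 2)) = A (x 0) (x 1) (x 2).

Definition is_derivation A (D : V -> V) :=
  linear D /\
  forall x y z, D (A x y z) = A (D x) y z + A x (D y) z + A x y (D z).

Definition jordanD A (x y : V * V) (z : V) :=
  A (A z x.1 x.2) y.1 y.2 - A (A z y.1 y.2) x.1 x.2.

Definition is_ternary_jordan A :=
  totally_commutative A /\ forall x y : V * V, is_derivation A (jordanD A x y).

Definition reduced A (a x y : V) := A a x y.

Lemma reduced_bilinear A a :
  bilinear_for (GRing.Scale.Law.clone _ _ *:%R _)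
               (GRing.Scale.Law.clone _ _ *:%R _) (reduced A a).
Proof. by split=> u; [exact: tprod_linear2 | exact: tprod_linear3]. Qed.

HB.instance Definition _ A a :=
  bilinear_isBilinear.Build F V V V *:%R *:%R (reduced A a)
    (reduced_bilinear A a).

Definition is_jordan (m : {bilinear V -> V -> V}) :=
  [/\ 2%N \notin [pchar F],
      forall x y, m x y = m y x
    & forall x y, m (m x y) (m x x) = m x (m y (m x x))].

End TernaryAlgebras.

Record ternaryJordanAlgebra (F : fieldType) (V : lmodType F) :=
  TernaryJordanAlgebra {
    tjordan_alg :> ternaryAlgebra V;
    tjordanP : is_ternary_jordan tjordan_alg }.

Section FormAlgebra.
Variables (F : fieldType) (V : lmodType F) (form : {symmetric V}).

Definition form_tprod (x y z : V) : V :=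
  form y z *: x + form x z *: y + form x y *: z.

Lemma sym_formC x y : form x y = form y x.
Proof. by rewrite hermC expr0 mul1r. Qed.

Lemma form_tprodC12 x y z : form_tprod x y z = form_tprod y x z.
Proof. by rewrite /form_tprod (sym_formC x y) (addrC (form y z *: x)). Qed.

Lemma form_tprodC23 x y z : form_tprod x y z = form_tprod x z y.
Proof. by rewrite /form_tprod (sym_formC y z) addrAC. Qed.

Lemma form_tprod_linear3 x y : linear (fun z => form_tprod x y z).
Proof.
move=> k u v; rewrite /form_tprod !linearPr /= !scalerDl !scalerDr !scalerA.
by rewrite (mulrC k (form x y)) (addrACA (_ *: x)) (addrACA (_ + _) (_ + _)).
Qed.

Lemma form_tprod_linear2 x z : linear (fun y => form_tprod x y z).
Proof. by move=> k u v; rewrite !(form_tprodC23 x _ z) form_tprod_linear3. Qed.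

Lemma form_tprod_linear1 y z : linear (fun x => form_tprod x y z).
Proof. by move=> k u v; rewrite !(form_tprodC12 _ y z) form_tprod_linear2. Qed.

Definition form_ternary : ternaryAlgebra V :=
  TernaryAlgebra form_tprod_linear1 form_tprod_linear2 form_tprod_linear3.

Lemma form_ternary_comm : totally_commutative form_ternary.
Proof.
move=> s x /=.
have cases (i : 'I_3) : [\/ i = 0, i = 1 | i = 2].
  by case: i => [[|[|[|//]]] ?]; [apply: Or31|apply: Or32|apply: Or33];
    apply: val_inj.
have neq i j : i != j -> s i <> s j by move=> /eqP ij /perm_inj.
have := (neq 0 1 isT, neq 0 2 isT, neq 1 2 isT).
have tC12 := form_tprodC12; have tC23 := form_tprodC23.
by case: (cases (s 0)) => ->; case: (cases (s 1)) => ->;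
  case: (cases (s 2)) => -> [[// ? ?] ?] //; rewrite // tC12 // tC23 // tC12.
Qed.

Lemma form_tprod_adj u v x1 x2 :
  form (form_tprod u x1 x2) v = form u (form_tprod v x1 x2).
Proof.
rewrite /form_tprod !linearDl !linearDr !linearZl_LR !linearZr_LR /=.
rewrite (sym_formC x1 v) (sym_formC x2 v); ring.
Qed.

Lemma form_jordanD_skew x y u v :
  form (jordanD form_ternary x y u) v = - form u (jordanD form_ternary x y v).
Proof.
have formBl w w' : form (w - w') v = form w v - form w' v by exact: linearBl.
have formBr w w' : form u (w - w') = form u w - form u w' by exact: linearBr.
by rewrite /jordanD /= formBl formBr !form_tprod_adj opprB.
Qed.

Lemma form_jordanD_linear x y : linear (jordanD form_ternary x y).
Proof.
move=> k u v; rewrite /jordanD /= !form_tprod_linear1.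
by rewrite scalerBr opprD addrACA.
Qed.

Lemma skew_derivation (D : V -> V) : linear D ->
  (forall u v, form (D u) v = - form u (D v)) -> is_derivation form_ternary D.
Proof.
move=> linD skewD; split=> // x y z /=.
have DD u v : D (u + v) = D u + D v by have := linD 1 u v; rewrite !scale1r.
have D0 : D 0 = 0 by apply: (addrI (D 0)); rewrite -DD !addr0.
have DZ k u : D (k *: u) = k *: D u by rewrite -[k *: u]addr0 linD D0 addr0.
rewrite /form_tprod !DD !DZ !skewD !scaleNr.
rewrite [RHS](AC (3*3*3) ((1*5*9)*(2*8)*(3*6)*(4*7)))/=.
by rewrite !addNr !addr0.
Qed.

Lemma form_ternary_jordan : is_ternary_jordan form_ternary.
Proof.
split=> [|x y]; first exact: form_ternary_comm.
by apply: skew_derivation; [exact: form_jordanD_linear|exact: form_jordanD_skew].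
Qed.

Definition form_tjordan : ternaryJordanAlgebra V :=
  TernaryJordanAlgebra form_ternary_jordan.

End FormAlgebra.

(* Main.v *)
Require Import Defs.
From mathcomp Require Import all_boot all_fingroup all_algebra.
From mathcomp Require Import ring.

Set Implicit Arguments.
Unset Strict Implicit.
Unset Printing Implicit Defensive.

Import GRing.Theory.
Local Open Scope ring_scope.

(** Write [x . y] for the product [[a, x, y]], and let [alpha = (a, a)], which
    is nonzero. Since [a . a = 3 alpha a], the vector [e = a / (3 alpha)] is an
    idempotent, and every [v] orthogonal to [a] satisfies [e . v = v / 3]. In a
    Jordan algebra the multiplication by an idempotent has its eigenvalues in
    {0, 1/2, 1}, so one nonzero [v] orthogonal to [a] rules out the Jordan
    identity.

    The proof makes this concrete without the Peirce decomposition. The plane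
    spanned by [a] and [v] is a subalgebra ([reduced_planeE]), and at
    [x = s a + v], [y = a] the two sides of [(x y) x^2 = x (y x^2)] differ by
    [- 2 alpha^2 (alpha s^2 + (v, v)) v] ([jordan_defect]). If this vanishes
    for both [s = 1] and [s = 2], then subtracting the two conditions gives
    [3 alpha = 0]. A nonzero [v] exists because two orthonormal vectors cannot
    both be multiples of [a] ([exists_orthogonal]). *)

Section ReducedAlgebra.
Variables (F : fieldType) (V : lmodType F) (form : {symmetric V}) (a : V).

Local Notation alpha := (form a a).
Local Notation "x ** y" := (reduced (form_tjordan form) a x y)
  (at level 40, left associativity).

Section Plane.
Variables (v : V) (av0 : form a v = 0).

Lemma reduced_planeE p r p' r' :
  (p *: a + r *: v) ** (p' *: a + r' *: v) =
    (3 * alpha * p * p' + form v v * r * r') *: a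
    + alpha * (p * r' + r * p') *: v.
Proof.
have va0 : form v a = 0 by rewrite sym_formC.
rewrite /reduced /= /form_tprod !(linearDl, linearDr) !(linearZl_LR, linearZr_LR).
rewrite /= av0 va0 !(mulr0, addr0, add0r) !scalerDr !scalerA.
rewrite -addrA (addrACA ((p' * alpha * p) *: a)) [LHS]addrA -!scalerDl.
by congr (_ *: _ + _ *: _); ring.
Qed.

(** The coefficients of [a] on the two sides agree, so the whole defect lies on
    the line of [v]. When [2 alpha] is nonzero its factor is genuinely quadratic
    in [s], so even an isotropic [v] leaves values of [s] that refute the
    Jordan identity. *)
Lemma jordan_defect s (x := s *: a + v) :
  (x ** a) ** (x ** x) - x ** (a ** (x ** x)) =
    - (2 * alpha ^+ 2 * (alpha * s ^+ 2 + form v v)) *: v.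
Proof.
have xE : x = s *: a + 1 *: v by rewrite scale1r.
have aE : a = 1 *: a + 0 *: v by rewrite scale1r scale0r addr0.
have -> : x ** a = (3 * alpha * s) *: a + alpha *: v.
  by rewrite xE [X in _ ** X]aE reduced_planeE; congr (_ *: _ + _ *: _); ring.
have -> : x ** x = (3 * alpha * s ^+ 2 + form v v) *: a + (2 * alpha * s) *: v.
  by rewrite xE reduced_planeE; congr (_ *: _ + _ *: _); ring.
set P := 3 * alpha * s ^+ 2 + form v v.
have -> : a ** (P *: a + (2 * alpha * s) *: v) =
    (3 * alpha * P) *: a + (2 * alpha ^+ 2 * s) *: v.
  by rewrite [X in X ** _]aE reduced_planeE; congr (_ *: _ + _ *: _); ring.
rewrite xE !reduced_planeE opprD addrACA -!scalerBl.
rewrite -[RHS]add0r -(scale0r a) /P; congr (_ *: _ + _ *: _); ring.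
Qed.

End Plane.

(** The witness is the orthogonal projection of [e] or of [f] along [a]: if both
    projections vanish, [e] and [f] lie on one line and cannot be orthonormal. *)
Lemma exists_orthogonal e f :
    alpha != 0 -> form e e = 1 -> form f f = 1 -> form e f = 0 ->
  exists2 v, v != 0 & form a v = 0.
Proof.
move=> alpha0 ee ff ef.
pose proj u := u - (form a u / alpha) *: a.
have projP u : form a (proj u) = 0.
  have -> : form a (proj u) = form a u - form a ((form a u / alpha) *: a).
    exact: linearBr.
  by rewrite linearZr_LR /= divfK // subrr.
have [pe0|] := eqVneq (proj e) 0; last by exists (proj e).
have [pf0|] := eqVneq (proj f) 0; last by exists (proj f).
move/eqP: pe0; rewrite subr_eq0 => /eqP eE.
move/eqP: pf0; rewrite subr_eq0 => /eqP fE.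
move: eE fE ee ff ef; set c := _ / _; set d := _ / _ => -> ->.
rewrite !linearZl_LR !linearZr_LR /= => ee ff ef.
(* [(e, e) (f, f) = (e, f)^2] since both vectors lie on the line of [a]. *)
have : (c * (c * alpha)) * (d * (d * alpha)) = (c * (d * alpha)) ^+ 2 by ring.
by rewrite ee ff ef expr0n mulr1 => /eqP; rewrite oner_eq0.
Qed.

Lemma reduced_not_jordan v :
    3 != 0 :> F -> alpha != 0 -> v != 0 -> form a v = 0 ->
  ~ is_jordan (reduced (form_tjordan form) a).
Proof.
move=> three0 alpha0 v0 av0 [two0 _ jordan].
have two_neq0 : 2 != 0 :> F by rewrite inE /= in two0.
have vanish s : alpha * s ^+ 2 + form v v = 0.
  have /eqP := jordan_defect av0 s.
  rewrite jordan subrr eq_sym scaler_eq0 (negPf v0) orbF oppr_eq0 !mulf_eq0.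
  by rewrite (negPf two_neq0) (negPf alpha0) /= => /eqP.
have : 3 * alpha = (alpha * 2 ^+ 2 + form v v) - (alpha * 1 ^+ 2 + form v v).
  by ring.
by rewrite !vanish subrr => /eqP; rewrite mulf_eq0 (negPf three0) (negPf alpha0).
Qed.

End ReducedAlgebra.

Theorem theorem20 (F : fieldType) (charF : [pchar F] =i pred0)
    (n : nat) (n_gt1 : (1 < n)%N) (V : vectType F)
    (b : n.-tuple V) (b_basis : basis_of {:V} b)
    (form : {symmetric V}) (form_nondeg : nondegenerate form)
    (form_b : forall i j : 'I_n, form b`_i b`_j = (i == j)%:R)
    (a : V) (a_aniso : form a a != 0) :
  ~ is_jordan (reduced (form_tjordan form) a).
Proof.
pose i0 := Ordinal (ltnW n_gt1); pose i1 := Ordinal n_gt1.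
have three0 : 3 != 0 :> F by rewrite (pcharf0P F).1.
have [v v0 av0] := exists_orthogonal a_aniso
  (form_b i0 i0) (form_b i1 i1) (form_b i0 i1).
exact: reduced_not_jordan three0 a_aniso v0 av0.
Qed.
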